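(* Let $E$ be a directed graph with no sinks or sources, let $(E,\mathcal{L})$ be a labeled graph over a finite alphabet $\mathcal{A}$ such that $(E,\mathcal{L},\mathcal{E})$ is weakly left-resolving, and let $(\mathbb{E}^0,\mathbb{E}^1,d,r)$ be the topological graph of $(E,\mathcal{L},\mathcal{E})$. Then $d:\mathbb{E}^1\to\mathbb{E}^0$ is injective if and only if $$r(a)\cap r(b)=\emptyset\quad\text{for all } a,b\in\mathcal{A}\text{ with } a\neq b.$$ In particular, this disjointness condition holds if $C^*(E,\mathcal{L},\mathcal{E})$ is finite.
   Context: A directed graph $E=(E^0,E^1,r,s)$ consists of vertices $E^0$, edges $E^1$ and range and source maps $r,s:E^1\to E^0$. It has no sinks or sources if $s$ and $r$ are both surjective. $E^n$ is the set of paths $\lambda=\lambda_1\cdots\lambda_n$ of length $n$ (with $r(\lambda_i)=s(\lambda_{i+1})$), and $E^{\ge 1}=\bigcup_{n\ge1}E^n$; put $s(\lambda)=s(\lambda_1)$, $r(\lambda)=r(\lambda_n)$. A labeled graph $(E,\mathcal{L})$ over an alphabet $\mathcal{A}$ is a directed graph with a surjective labeling map $\mathcal{L}:E^1\to\mathcal{A}$, extended to paths by $\mathcal{L}(\lambda_1\cdots\lambda_n)=\mathcal{L}(\lambda_1)\cdots\mathcal{L}(\lambda_n)$. Put $\mathcal{L}^*(E)=\mathcal{L}(E^{\geq 1})$. For $\alpha\in\mathcal{L}^*(E)$ and $A\subset E^0$, $r(\alpha)=\{r(\lambda):\lambda\in E^{\ge1},\ \mathcal{L}(\lambda)=\alpha\}$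 and $r(A,\alpha)=\{r(\lambda):\lambda\in E^{\ge 1},\ s(\lambda)\in A,\ \mathcal{L}(\lambda)=\alpha\}$. $\mathcal{E}$ denotes the smallest collection of subsets of $E^0$ that contains $r(\alpha)$ for all $\alpha\in\mathcal{L}^*(E)$ and is closed under finite unions, finite intersections, relative complements, and $A\mapsto r(A,\alpha)$ for all $\alpha\in\mathcal{L}^*(E)$. $(E,\mathcal{L},\mathcal{E})$ is weakly left-resolving if $r(A,\alpha)\cap r(B,\alpha)=r(A\cap B,\alpha)$ for all $A,B\in\mathcal{E}$, $\alpha\in\mathcal{L}^*(E)$. $C^*(E,\mathcal{L},\mathcal{E})$ is the universal $C^*$-algebra generated by projections $\{p_A: A\in\mathcal{E}\}$ and partial isometries $\{s_a:a\in\mathcal{A}\}$ such that for $A,B\in\mathcal{E}$, $a,b\in\mathcal{A}$: (i) $p_\emptyset=0$, $p_{A\cap B}=p_Ap_B$, $p_{A\cup B}=p_A+p_B-p_{A\cap B}$; (ii) $p_As_a=s_ap_{r(A,a)}$; (iii) $s_a^*s_a=p_{r(a)}$, and $s_a^*s_b=0$ unless $a=b$; (iv) $p_A=\sum_{a\in\mathcal{L}(AE^1)}s_ap_{r(A,a)}s_a^*$, where $AE^1=\{e\in E^1:s(e)\in A\}$. A $C^*$-algebra is finite if it has no infinite projections. Topological graph of $(E,\mathcal{L},\mathcal{E})$: $\widehat{\mathcal{E}}$ is the set of ultrafilters of the Boolean algebra $\mathcal{E}$, with the topology having basis $Z(A)=\{\xi\in\widehat{\mathcal{E}}:A\in\xi\}$,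 $A\in\mathcal{E}$. For $a\in\mathcal{A}$ let $\mathcal{I}_a=\{B\in\mathcal{E}:B\subset r(a)\}$, a Boolean algebra with ultrafilter space $\widehat{\mathcal{I}}_a$ (topologized in the same way), and for $\xi\in\widehat{\mathcal{I}}_a$ let $\iota(\xi)=\{A\in\mathcal{E}:A\supset B\text{ for some }B\in\xi\}\in\widehat{\mathcal{E}}$ and $\widehat{\theta}_a(\xi)=\{A\in\mathcal{E}:r(A,a)\in\xi\}\in\widehat{\mathcal{E}}$. Then $\mathbb{E}^0=\widehat{\mathcal{E}}$, $\mathbb{E}^1=\bigsqcup_{a\in\mathcal{A}}\widehat{\mathcal{I}}_a$ (disjoint union), the element of $\mathbb{E}^1$ given by $\xi\in\widehat{\mathcal{I}}_a$ is written $e^a_\xi$, and $d,r:\mathbb{E}^1\to\mathbb{E}^0$ are $d(e^a_\xi)=\iota(\xi)$, $r(e^a_\xi)=\widehat{\theta}_a(\xi)$. *)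

(* Defs.v *)
From HB Require Import structures.
From mathcomp Require Import all_boot all_order all_algebra complex.
From mathcomp Require Import all_classical all_reals all_analysis.

Set Implicit Arguments.
Unset Strict Implicit.
Unset Printing Implicit Defensive.

Import Order.TTheory GRing.Theory Num.Theory numFieldNormedType.Exports.

Local Open Scope classical_set_scope.
Local Open Scope ring_scope.

Record digraph := Digraph {
  vertex : Type;
  edge : Type;
  src : edge -> vertex;
  rng : edge -> vertex }.

Definition no_sinks_or_sources (E : digraph) : Prop :=
  set_surj setT setT (@src E) /\ set_surj setT setT (@rng E).

Record labeled_graph (Lab : Type) := LabeledGraph {
  lgraph :> digraph;
  label : edge lgraph -> Lab;
  label_surj : set_surj setT setT label }.

Section LabeledGraph.
Variables (Lab : Type) (E : labeled_graph Lab).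
Notation V := (vertex E).

(* A path of length [n.+1] is represented by its first edge and the sequence
   of its [n] remaining edges, so that all paths have positive length. *)
Definition paths : set (edge E * seq (edge E)) :=
  [set l | path (fun e f => `[< rng e = src f >]) l.1 l.2].

Definition path_src (l : edge E * seq (edge E)) : V := src l.1.
Definition path_rng (l : edge E * seq (edge E)) : V := rng (last l.1 l.2).
Definition path_label (l : edge E * seq (edge E)) : seq Lab :=
  map (@label _ E) (l.1 :: l.2).

Definition words : set (seq Lab) := path_label @` paths.

Definition word_range (w : seq Lab) : set V :=
  path_rng @` [set l | paths l /\ path_label l = w].

Definition rel_range (A : set V) (w : seq Lab) : set V :=
  path_rng @` [set l | [/\ paths l, A (path_src l) & path_label l = w]].

(* [set0] is the empty finite union. *)
Definition accommodating (B : set (set V)) : Prop :=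
  [/\ B set0,
      forall A A', B A -> B A' -> B (A `|` A'),
      forall A A', B A -> B A' -> B (A `&` A'),
      forall A A', B A -> B A' -> B (A `\` A') &
      forall A w, B A -> words w -> B (rel_range A w)].

Definition accE : set (set V) := smallest accommodating (word_range @` words).

Definition weakly_left_resolving : Prop :=
  forall A B w, accE A -> accE B -> words w ->
    rel_range A w `&` rel_range B w = rel_range (A `&` B) w.

(* L(A E^1) *)
Definition out_labels (A : set V) : set Lab :=
  @label _ E @` [set e | A (src e)].

Definition ideal (a : Lab) : set (set V) :=
  [set B | accE B /\ B `<=` word_range [:: a]].

Lemma words1 a : words [:: a].
Proof.
have [e _ <-] := @label_surj _ E a I.
by exists (e, [::]).
Qed.

Lemma accE_accommodating : accommodating accE.
Proof.
split.
- by move=> B [[]].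
- by move=> A A' hA hA' B hB; have [[_ h _ _ _] _] := hB; apply: h; [exact: hA|exact: hA'].
- by move=> A A' hA hA' B hB; have [[_ _ h _ _] _] := hB; apply: h; [exact: hA|exact: hA'].
- by move=> A A' hA hA' B hB; have [[_ _ _ h _] _] := hB; apply: h; [exact: hA|exact: hA'].
- by move=> A w hA hw B hB; have [[_ _ _ _ h] _] := hB; apply: h => //; exact: hA.
Qed.

Lemma accE_range a : accE (word_range [:: a]).
Proof. by apply: sub_gen_smallest; exists [:: a] => //; exact: words1. Qed.

Lemma rel_range_sub A w : rel_range A w `<=` word_range w.
Proof. by move=> v [l [pl _ hl] <-]; exists l. Qed.

Lemma rel_rangeS A B w : A `<=` B -> rel_range A w `<=` rel_range B w.
Proof. by move=> AB v [l [pl Al hl] <-]; exists l => //; split => //; exact: AB. Qed.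

Lemma rel_range0 w : rel_range set0 w = set0.
Proof. by apply/seteqP; split => // v [l [_ []]]. Qed.

Lemma rel_rangeT w : rel_range setT w = word_range w.
Proof.
apply/seteqP; split; first exact: rel_range_sub.
by move=> v [l [pl hl] <-]; exists l.
Qed.

Lemma rel_rangeU A B w :
  rel_range (A `|` B) w = rel_range A w `|` rel_range B w.
Proof.
apply/seteqP; split.
  by move=> v [l [pl [Al|Bl] hl] <-]; [left|right]; exists l.
by move=> v []; apply: rel_rangeS => x; [left|right].
Qed.

Lemma ideal_rel_range A a : accE A -> ideal a (rel_range A [:: a]).
Proof.
move=> hA; split; last exact: rel_range_sub.
by have [_ _ _ _ h] := accE_accommodating; apply: h => //; exact: words1.
Qed.

End LabeledGraph.

Arguments paths {Lab} E.
Arguments words {Lab} E.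
Arguments word_range {Lab} E w.
Arguments accE {Lab} E.
Arguments ideal {Lab} E a.
Arguments words1 {Lab} E a.

Lemma accE_setT (Lab : finType) (E : labeled_graph Lab) :
  no_sinks_or_sources E -> accE E setT.
Proof.
move=> [_ rngS].
have [h0 hU _ _ _] := accE_accommodating E.
have -> : setT = \big[setU/set0]_(a : Lab) word_range E [:: a].
  apply/seteqP; split => // v _.
  have [e _ <-] := rngS v I.
  by rewrite (bigD1 (label e)) //=; left; exists (e, [::]).
by elim/big_ind: _ => // a _; exact: accE_range.
Qed.

Section Ultrafilters.
Variables (T : Type) (B : set (set T)).

(* The Boolean algebra [B] need not have a top element. *)
Definition bfilter (xi : set (set T)) : Prop :=
  [/\ xi `<=` B, xi !=set0, ~ xi set0,
      forall A A', xi A -> xi A' -> xi (A `&` A') &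
      forall A A', xi A -> B A' -> A `<=` A' -> xi A'].

Definition ultrafilter (xi : set (set T)) : Prop :=
  bfilter xi /\ forall eta, bfilter eta -> xi `<=` eta -> eta = xi.

Definition spectrum := {xi : set (set T) | ultrafilter xi}.

Definition basicZ (A : set T) : set spectrum := [set xi | sval xi A].

Definition spectrum_open (U : set spectrum) : Prop :=
  forall xi, U xi -> exists A, [/\ B A, basicZ A xi & basicZ A `<=` U].

HB.instance Definition _ := gen_eqMixin spectrum.
HB.instance Definition _ := gen_choiceMixin spectrum.

Let spectrum_openT : spectrum_open setT.
Proof.
move=> [xi uxi] _; have [[sB [A xiA] _ _ _] _] := uxi.
by exists A; split => //; exact: sB.
Qed.

Let spectrum_openI U W :
  spectrum_open U -> spectrum_open W -> spectrum_open (U `&` W).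
Proof.
move=> hU hW xi [Uxi Wxi].
have [A [BA xiA AU]] := hU _ Uxi.
have [C [BC xiC CW]] := hW _ Wxi.
have [[sB _ _ hI _] _] := svalP xi.
have xiAC := hI _ _ xiA xiC.
exists (A `&` C); split => //; first exact: sB.
move=> eta etaAC; have [[_ _ _ _ up] _] := svalP eta.
split; [apply: AU|apply: CW]; apply: (up _ _ etaAC) => //.
Qed.

Let spectrum_open_bigcup (I : Type) (f : I -> set spectrum) :
  (forall i, spectrum_open (f i)) -> spectrum_open (\bigcup_i f i).
Proof.
move=> hf xi [i _ fi]; have [A [BA xiA Af]] := hf i _ fi.
by exists A; split => // eta /Af; exists i.
Qed.

HB.instance Definition _ := isOpenTopological.Build spectrum
  spectrum_openT spectrum_openI spectrum_open_bigcup.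

End Ultrafilters.

Record topological_graph := TopologicalGraph {
  tvertex : topologicalType;
  tedge : topologicalType;
  tdom : tedge -> tvertex;
  trng : tedge -> tvertex }.

Section TopologicalGraph.
Variables (Lab : finType) (E : labeled_graph Lab).

Definition iota_set (xi : set (set (vertex E))) : set (set (vertex E)) :=
  [set A | accE E A /\ exists2 B, xi B & B `<=` A].

Definition theta_set (a : Lab) (xi : set (set (vertex E))) :
    set (set (vertex E)) :=
  [set A | accE E A /\ xi (rel_range A [:: a])].

Lemma iota_ultrafilter a xi :
  ultrafilter (ideal E a) xi -> ultrafilter (accE E) (iota_set xi).
Proof.
have [_ _ accI _ _] := accE_accommodating E.
move=> [[sI [B xiB] n0 hI up] maxi]; split.
  split.
  - by move=> A [].
  - by exists B; split; [have [] := sI _ xiB|exists B].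
  - by move=> [_ [C xiC]]; rewrite subset0 => C0; apply: n0; rewrite -C0.
  - move=> A A' [hA [C xiC CA]] [hA' [C' xiC' CA']]; split; first exact: accI.
    by exists (C `&` C'); [exact: hI|exact: setISS].
  - move=> A A' [hA [C xiC CA]] hA' AA'; split => //.
    by exists C => //; exact: subset_trans AA'.
move=> eta [eE _ en0 eI eup] sub.
have xi_sub C : xi C -> eta C.
  move=> xiC; apply: sub; split; first by have [] := sI _ xiC.
  by exists C.
have eq_xi : eta `&` ideal E a = xi.
  apply: maxi; last by move=> C xiC; split; [exact: xi_sub|exact: sI].
  split.
  - by move=> C [].
  - by exists B; split; [exact: xi_sub|exact: sI].
  - by move=> [].
  - move=> C C' [eC [hC Ca]] [eC' [hC' _]]; split; first exact: eI.
    by split; [exact: accI|move=> x [/Ca]].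
  - move=> C C' [eC _] iC' CC'; split => //.
    by apply: eup CC' => //; case: iC'.
apply/seteqP; split => // A eA; split; first exact: eE.
exists (A `&` B); last exact: subIsetl.
rewrite -eq_xi; split; first by apply: eI => //; exact: xi_sub.
have [hB Ba] := sI _ xiB.
by split; [apply: accI => //; exact: eE|move=> x [_ /Ba]].
Qed.

Hypotheses (hE : no_sinks_or_sources E) (hwlr : weakly_left_resolving E).

Lemma theta_ultrafilter a xi :
  ultrafilter (ideal E a) xi -> ultrafilter (accE E) (theta_set a xi).
Proof.
have [_ _ accI accD _] := accE_accommodating E.
have accT := accE_setT hE.
have w1 := words1 E a.
move=> [[sI [B xiB] n0 hI up] maxi].
have ra : xi (word_range E [:: a]).
  by apply: (up B) => //; [split => //; exact: accE_range|have [] := sI _ xiB].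
have fil : bfilter (accE E) (theta_set a xi).
  split.
  - by move=> A [].
  - by exists setT; split => //; rewrite rel_rangeT.
  - by move=> [_]; rewrite rel_range0.
  - move=> A A' [hA xA] [hA' xA']; split; first exact: accI.
    by rewrite -hwlr //; exact: hI.
  - move=> A A' [hA xA] hA' AA'; split => //.
    by apply: (up _ _ xA); [exact: ideal_rel_range|exact: rel_rangeS].
split => // eta [eE _ en0 eI eup] sub.
apply/seteqP; split => // A eA.
have hA := eE _ eA; split => //.
have iA := ideal_rel_range a hA.
have hC : accE E (setT `\` A) by exact: accD.
apply: contrapT => nxA.
have xiN0 : forall C, xi C -> C `&` rel_range A [:: a] !=set0.
  move=> C xiC; apply/set0P/eqP => CA0; apply: en0.
  rewrite -(setICr A) -setTD; apply: eI => //; apply: sub; split => //.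
  apply: (up _ _ xiC); first exact: ideal_rel_range.
  move=> x Cx; have [_ Ca] := sI _ xiC.
  have : rel_range (A `|` setT `\` A) [:: a] x.
    by rewrite setTD setUv rel_rangeT; exact: Ca.
  rewrite rel_rangeU => -[Ax|//]; suff : set0 x by [].
  by rewrite -CA0; split.
pose xi' := [set D | ideal E a D /\
  exists2 C, xi C & C `&` rel_range A [:: a] `<=` D].
suff e : xi' = xi by apply: nxA; rewrite -e; split => //; exists B => // x [].
apply: maxi; last first.
  by move=> F xiF; split; [exact: sI|exists F => // x []].
split.
- by move=> D [].
- by exists (rel_range A [:: a]); split => //; exists B => // x [].
- by move=> [_ [F xiF F0]]; have [x Cx] := xiN0 _ xiF; exact: (F0 _ Cx).
- move=> D D' [[hD Da] [F xiF CD]] [[hD' _] [F' xiF' CD']]; split.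
    by split; [exact: accI|move=> x [/Da]].
  exists (F `&` F'); first exact: hI.
  by move=> x [[Fx F'x] Ax]; split; [exact: CD|exact: CD'].
- move=> D D' [_ [F xiF CD]] iD' DD'; split => //.
  by exists F => //; exact: subset_trans DD'.
Qed.

(* [existT _ a xi] is the edge written e^a_xi; the topology on [labeled_tedge]
   is the disjoint union topology. *)
Definition labeled_tvertex : topologicalType := spectrum (accE E).
Definition labeled_tedge : topologicalType :=
  {a : Lab & spectrum (ideal E a)}.

Definition labeled_tdom (e : labeled_tedge) : labeled_tvertex :=
  exist _ (iota_set (sval (projT2 e))) (iota_ultrafilter (svalP (projT2 e))).

Definition labeled_trng (e : labeled_tedge) : labeled_tvertex :=
  exist _ (theta_set (projT1 e) (sval (projT2 e)))
    (theta_ultrafilter (svalP (projT2 e))).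

Definition labeled_topological_graph : topological_graph :=
  TopologicalGraph labeled_tdom labeled_trng.

End TopologicalGraph.

(* C*-algebras are complex and need not be unital. *)
HB.mixin Record CompleteNormedModule_isCStarAlgebra (R : realType) A
    of CompleteNormedModule R[i] A := {
  cmul : A -> A -> A;
  cstar : A -> A;
  cmulA : associative cmul;
  cmulDl : left_distributive cmul +%R;
  cmulDr : right_distributive cmul +%R;
  cmulZl : forall (k : R[i]) x y, cmul (k *: x) y = k *: cmul x y;
  cmulZr : forall (k : R[i]) x y, cmul x (k *: y) = k *: cmul x y;
  cstarK : involutive cstar;
  cstarD : {morph cstar : x y / x + y};
  cstarZ : forall (k : R[i]) x, cstar (k *: x) = k^* *: cstar x;
  cstarM : forall x y, cstar (cmul x y) = cmul (cstar y) (cstar x);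
  norm_cmul : forall x y, `|cmul x y| <= `|x| * `|y|;
  norm_cstar_cmul : forall x, `|cmul (cstar x) x| = `|x| ^+ 2 }.

#[short(type="cstarAlgType")]
HB.structure Definition CStarAlgebra (R : realType) :=
  {A of CompleteNormedModule_isCStarAlgebra R A & CompleteNormedModule R[i] A}.

Notation "x ** y" := (cmul x y) (at level 40, left associativity) : ring_scope.

Section CStarAlgebras.
Variables (R : realType) (A : cstarAlgType R).

Definition projection (p : A) : Prop := cstar p = p /\ p ** p = p.

Definition partial_isometry (v : A) : Prop := v ** cstar v ** v = v.

(* For projections, [p ** q = q] is [q <= p]. *)
Definition subprojection (q p : A) : Prop := p ** q = q.

Definition mvn_equiv (p q : A) : Prop :=
  exists v : A, cstar v ** v = p /\ v ** cstar v = q.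

Definition infinite_projection (p : A) : Prop :=
  projection p /\
  exists q, [/\ projection q, subprojection q p, q <> p & mvn_equiv p q].

Definition finite_cstar : Prop := forall p : A, ~ infinite_projection p.

Definition closed_star_subalgebra (S : set A) : Prop :=
  [/\ S 0 /\ (forall x y, S x -> S y -> S (x + y)),
      forall (k : R[i]) x, S x -> S (k *: x),
      forall x y, S x -> S y -> S (x ** y),
      forall x, S x -> S (cstar x) &
      closed S].

Definition generated_by (X : set A) : Prop :=
  smallest closed_star_subalgebra X = setT.

End CStarAlgebras.

Definition star_hom (R : realType) (A B : cstarAlgType R)
    (phi : {linear A -> B}) : Prop :=
  {morph phi : x y / x ** y} /\ {morph phi : x / cstar x}.

Section LabeledGraphCStar.
Variables (R : realType) (Lab : finType) (E : labeled_graph Lab).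

(* Only the values of [p] on [accE E] are relevant. *)
Record representation (A : cstarAlgType R) (p : set (vertex E) -> A)
    (s : Lab -> A) : Prop := Representation {
  rep_proj : forall X, accE E X -> projection (p X);
  rep_pisom : forall a, partial_isometry (s a);
  rep0 : p set0 = 0;
  repI : forall X Y, accE E X -> accE E Y -> p (X `&` Y) = p X ** p Y;
  repU : forall X Y, accE E X -> accE E Y ->
    p (X `|` Y) = p X + p Y - p (X `&` Y);
  rep_comm : forall X a, accE E X ->
    p X ** s a = s a ** p (rel_range X [:: a]);
  rep_source : forall a, cstar (s a) ** s a = p (word_range E [:: a]);
  rep_orth : forall a b, a <> b -> cstar (s a) ** s b = 0;
  rep_sum : forall X, accE E X ->
    p X = \sum_(a : Lab | `[< out_labels X a >])
            s a ** p (rel_range X [:: a]) ** cstar (s a) }.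

(* [A], with the generators [p] and [s], is C*(E, L, accE E); this
   determines the triple up to isomorphism. *)
Definition is_labeled_graph_cstar (A : cstarAlgType R)
    (p : set (vertex E) -> A) (s : Lab -> A) : Prop :=
  [/\ representation p s,
      generated_by ((p @` accE E) `|` [set s a | a in setT]) &
      forall (B : cstarAlgType R) (q : set (vertex E) -> B) (t : Lab -> B),
        representation q t ->
        exists phi : {linear A -> B},
          [/\ star_hom phi,
              forall X, accE E X -> phi (p X) = q X &
              forall a, phi (s a) = t a] ].

End LabeledGraphCStar.

(* Main.v *)
Require Import Defs.
From HB Require Import structures.
From mathcomp Require Import all_boot all_order all_algebra complex.
From mathcomp Require Import all_classical all_reals all_analysis.
From mathcomp Require Import finmap ring lra.
From mathcomp.analysis.showcase Require Import summability.

(** The domain map sends the edge e^a_xi to the ultrafilter generated by xi,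
    and xi is recovered as the trace of this ultrafilter on the ideal of a.
    So two distinct edges with the same domain carry distinct letters a and b,
    and their common domain contains both r(a) and r(b), which is absurd when
    these are disjoint. Conversely a vertex of r(a) and r(b) is the center of
    principal ultrafilters of both ideals, with the same image under the
    domain map. This is [tdom_injectiveP].

    Suppose now that the C*-algebra is finite. No vertex is a source, so the
    sets r(c) cover the vertices; let B_c be the part of r(c) which is not in
    r(d) for any earlier letter d. The B_c partition the vertex set, hence
    t = sum_c s_c p_(B_c) satisfies t* t = sum_c p_(B_c) = p_(E^0), while
    t t* is a subprojection of p_(E^0). Finiteness forces t t* = p_(E^0), and
    compressing by s_d gives p_(B_d) = p_(r(d)). If c is earlier than d then
    B_d misses r(c), so the projection of the intersection of r(c) and r(d)
    vanishes: this is [finite_range_meet0].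

    It remains to see that p_X is nonzero whenever X is nonempty, and by
    universality it suffices to exhibit one representation in which this
    holds. Send every infinite path of the graph to the sequence of its labels
    and of the principal ultrafilters of its vertices. As the labeled space is
    weakly left-resolving, the ultrafilter at the source of an edge is
    determined by the label and by the ultrafilter at its range
    ([theta_principal]), so on the space of these sequences each letter a
    acts by a partial bijection, which prepends a. The corresponding partial
    isometries of the Hilbert space of square summable functions, together
    with the multiplications by the indicators of the sets of paths that start
    in X, form a representation ([path_representation]); as there are no
    sinks, an infinite path starts at every vertex, so all these indicators
    are nonzero for X nonempty.

    This takes place in the C*-algebra of bounded operators of a Hilbert
    space. It is constructed below for spaces that are described by the real
    part of their inner product only. Since a scalar k is moved across the
    real part as its conjugate, a complex linear operator has the same adjoint
    for the real part as for the inner product, so no complex valued form is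
    needed. *)

Set Implicit Arguments.
Unset Strict Implicit.
Unset Printing Implicit Defensive.

Import Order.TTheory GRing.Theory Num.Theory numFieldNormedType.Exports.

Local Open Scope classical_set_scope.
Local Open Scope ring_scope.

(** * Bounded operators of a Hilbert space *)

(** [dot] is the real part of the inner product [dot x y + i dot x (i y)],
    which is sesquilinear by [dotZ] and [dotRl]; the latter does not follow
    from additivity without continuity. Completeness is stated for filters,
    because this is the form in which it passes to the space of operators. *)
Record hilbert (R : realType) := Hilbert {
  hcarrier :> lmodType R[i];
  dot : hcarrier -> hcarrier -> R;
  dotC : forall x y, dot x y = dot y x;
  dotDl : forall x y z, dot (x + y) z = dot x z + dot y z;
  dotZ : forall (k : R[i]) x y, dot (k *: x) y = dot x (k^* *: y);
  dotRl : forall (r : R) x y, dot ((r%:C)%C *: x) y = r * dot x y;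
  dot_ge0 : forall x, 0 <= dot x x;
  dot_eq0 : forall x, dot x x = 0 -> x = 0;
  hilbert_complete : forall F : set_system hcarrier, ProperFilter F ->
    (forall e, 0 < e -> exists x, F [set y | dot (y - x) (y - x) <= e]) ->
    exists l, forall e, 0 < e -> F [set y | dot (l - y) (l - y) <= e] }.

Lemma normr_normc (R : realType) (k : R[i]) : `|k| = (Normc.normc k)%:C%C.
Proof. by []. Qed.

Lemma normc_ge0 (R : realType) (k : R[i]) : 0 <= Normc.normc k.
Proof. by rewrite -ler0c -normr_normc. Qed.

Section HilbertTheory.
Variables (R : realType) (H : hilbert R).
Implicit Types x y z : H.

Definition hnorm x : R := Num.sqrt (dot x x).

Lemma dotDr x y z : dot x (y + z) = dot x y + dot x z.
Proof. by rewrite dotC dotDl !(dotC x). Qed.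

Lemma dotRr (r : R) x y : dot x ((r%:C)%C *: y) = r * dot x y.
Proof. by rewrite dotC dotRl dotC. Qed.

Lemma dotNl x y : dot (- x) y = - dot x y.
Proof.
have := dotRl (-1) x y.
by rewrite mulN1r rmorphN1 scaleN1r.
Qed.

Lemma dotNr x y : dot x (- y) = - dot x y.
Proof. by rewrite dotC dotNl dotC. Qed.

Lemma dotBl x y z : dot (x - y) z = dot x z - dot y z.
Proof. by rewrite dotDl dotNl. Qed.

Lemma dotBr x y z : dot x (y - z) = dot x y - dot x z.
Proof. by rewrite dotDr dotNr. Qed.

Lemma dot_polar x y :
  dot x y = 2^-1 * (dot (x + y) (x + y) - dot x x - dot y y).
Proof. by rewrite dotDl !dotDr (dotC y x); field. Qed.

Lemma dot0l x : dot 0 x = 0.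
Proof. by have := dotBl 0 0 x; rewrite !subrr. Qed.

Lemma dot_inj x y : (forall z, dot x z = dot y z) -> x = y.
Proof.
move=> xy; apply/eqP; rewrite -subr_eq0; apply/eqP/dot_eq0.
by rewrite dotBl xy subrr.
Qed.

Lemma sqr_hnorm x : hnorm x ^+ 2 = dot x x.
Proof. by rewrite sqr_sqrtr // dot_ge0. Qed.

Lemma hnorm_ge0 x : 0 <= hnorm x.
Proof. exact: sqrtr_ge0. Qed.

Lemma hnorm_eq0 x : hnorm x = 0 -> x = 0.
Proof. by move=> x0; apply: dot_eq0; rewrite -sqr_hnorm x0 expr0n. Qed.

Lemma hnorm0 : hnorm 0 = 0.
Proof. by rewrite /hnorm dot0l sqrtr0. Qed.

Lemma hnorm_le x (c : R) : 0 <= c -> dot x x <= c ^+ 2 -> hnorm x <= c.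
Proof.
move=> c0 h.
by rewrite -(ler_pXn2r (n := 2)) ?nnegrE ?hnorm_ge0 ?sqr_hnorm.
Qed.

Lemma hnormN x : hnorm (- x) = hnorm x.
Proof. by rewrite /hnorm dotNl dotNr opprK. Qed.

Lemma hnormZ (k : R[i]) x : hnorm (k *: x) = Normc.normc k * hnorm x.
Proof.
rewrite /hnorm dotZ scalerA mulrC -normCK normr_normc -rmorphXn dotRr.
by rewrite sqrtrM ?sqr_ge0 // sqrtr_sqr ger0_norm ?normc_ge0.
Qed.

Lemma cauchy_schwarz x y : dot x y <= hnorm x * hnorm y.
Proof.
have [x0|x0] := eqVneq (hnorm x) 0.
  by rewrite (hnorm_eq0 x0) dot0l hnorm0 mul0r.
have [y0|y0] := eqVneq (hnorm y) 0.
  by rewrite (hnorm_eq0 y0) dotC dot0l hnorm0 mulr0.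
have xp : 0 < hnorm x by rewrite lt_def x0 hnorm_ge0.
have yp : 0 < hnorm y by rewrite lt_def y0 hnorm_ge0.
(* the square of the norm of [|y| x - |x| y] is [2 |x| |y| (|x| |y| - dot x y)] *)
have := dot_ge0 (((hnorm y)%:C)%C *: x - ((hnorm x)%:C)%C *: y).
rewrite dotBl !dotBr !dotRl !dotRr -!sqr_hnorm (dotC y x) => h.
rewrite -(ler_pM2l (mulr_gt0 xp yp)).
nra.
Qed.

Lemma hnormD x y : hnorm (x + y) <= hnorm x + hnorm y.
Proof.
apply: hnorm_le; first by rewrite addr_ge0 ?hnorm_ge0.
rewrite dotDl !dotDr (dotC y x) -!sqr_hnorm.
have := cauchy_schwarz x y; nra.
Qed.

End HilbertTheory.

Section BoundedOperators.
Variables (R : realType) (H : hilbert R).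
Implicit Types S T : H -> H.

Definition adjoint_to S T := forall x y, dot (S x) y = dot x (T y).

Definition bounded_by (c : R) S :=
  0 <= c /\ forall x, hnorm (S x) <= c * hnorm x.

(** Additivity is a consequence of the existence of an adjoint. Homogeneity is
    not, since complex conjugation has an adjoint for [dot]. Asking for an
    adjoint spares the Riesz representation theorem. *)
Definition bounded_op : {pred H -> H} := [pred S | `[<
  [/\ forall (k : R[i]) x, S (k *: x) = k *: S x,
      exists c, bounded_by c S & exists T, adjoint_to S T] >]].

Lemma bounded_op_submod : submod_closed bounded_op.
Proof.
split.
  apply/asboolP; split.
  - by move=> k x; rewrite /= scaler0.
  - by exists 0; split => // x; rewrite hnorm0 mul0r.
  - by exists (fun=> 0) => x y; rewrite dot0l dotC dot0l.
move=> k S T /asboolP[SZ [c [c0 Sc]] [S' SS']] /asboolP[TZ [d [d0 Td]] [T' TT']].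
apply/asboolP; split.
- by move=> l x; rewrite !fctE /= SZ TZ scalerDr !scalerA mulrC.
- exists (Normc.normc k * c + d); split.
    by rewrite addr_ge0 // mulr_ge0 // normc_ge0.
  move=> x; apply: le_trans (hnormD _ _) _; rewrite mulrDl lerD //.
  by rewrite hnormZ -mulrA ler_wpM2l ?normc_ge0.
- exists (fun y => S' (k^* *: y) + T' y) => x y.
  by rewrite !fctE /= dotDl dotDr dotZ SS' TT'.
Qed.

HB.instance Definition _ :=
  GRing.isSubmodClosed.Build _ _ bounded_op bounded_op_submod.

Record bop := Bop { bop_val :> H -> H; _ : bop_val \in bounded_op }.
HB.instance Definition _ := [isSub for bop_val].
HB.instance Definition _ := [Choice of bop by <:].
HB.instance Definition _ := [SubChoice_isSubLmodule of bop by <:].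

Implicit Types A B : bop.

Lemma bop_inj A B : (forall x, A x = B x) -> A = B.
Proof. by move=> AB; apply: val_inj; apply/funext. Qed.

Lemma bopP A : [/\ forall (k : R[i]) x, A (k *: x) = k *: A x,
  exists c, bounded_by c A & exists T, adjoint_to A T].
Proof. by case: A => S /= /asboolP. Qed.

Lemma bopZ A (k : R[i]) x : A (k *: x) = k *: A x.
Proof. by have [h _ _] := bopP A. Qed.

Definition bop_adj A : H -> H := sval (cid (let: And3 _ _ h := bopP A in h)).

Lemma bop_adjP A : adjoint_to A (bop_adj A).
Proof. exact: svalP (cid _). Qed.

Lemma bop0 A : A 0 = 0.
Proof. by have := bopZ A 0 0; rewrite !scale0r. Qed.

Lemma bopD A x y : A (x + y) = A x + A y.
Proof. by apply: dot_inj => z; rewrite dotDl !(bop_adjP A) dotDl. Qed.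

Definition opnorm A : R := inf [set c | bounded_by c A].

Let bounds_has_inf A : has_inf [set c | bounded_by c A].
Proof.
by have [_ ? _] := bopP A; split=> //; exists 0 => c [].
Qed.

Lemma opnorm_le A (c : R) : bounded_by c A -> opnorm A <= c.
Proof. by move=> Ac; apply: ge_inf => //; have [] := bounds_has_inf A. Qed.

Lemma opnorm_bound A : bounded_by (opnorm A) A.
Proof.
have [ne lb] := bounds_has_inf A.
split; first by apply: lb_le_inf => // c [].
move=> x; have [x0|x0] := eqVneq (hnorm x) 0.
  by rewrite (hnorm_eq0 x0) bop0 !hnorm0 mulr0.
have xp : 0 < hnorm x by rewrite lt_def x0 hnorm_ge0.
rewrite -ler_pdivrMr //; apply: lb_le_inf => // c [_ /(_ x)].
by rewrite ler_pdivrMr.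
Qed.

Lemma opnorm_ge0 A : 0 <= opnorm A.
Proof. by have [] := opnorm_bound A. Qed.

Lemma opnormP A x : hnorm (A x) <= opnorm A * hnorm x.
Proof. by have [_] := opnorm_bound A; apply. Qed.

Lemma opnormD A B : opnorm (A + B) <= opnorm A + opnorm B.
Proof.
apply: opnorm_le; split=> [|x]; first by rewrite addr_ge0 ?opnorm_ge0.
by rewrite (le_trans (hnormD _ _)) // mulrDl lerD ?opnormP.
Qed.

Lemma opnorm_eq0 A : opnorm A = 0 -> A = 0.
Proof.
move=> A0; apply: bop_inj => x; apply: hnorm_eq0; apply/le_anti.
by rewrite hnorm_ge0 andbT (le_trans (opnormP A x)) // A0 mul0r.
Qed.

Let opnormZ_le (k : R[i]) A : opnorm (k *: A) <= Normc.normc k * opnorm A.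
Proof.
apply: opnorm_le; split=> [|x]; first by rewrite mulr_ge0 ?normc_ge0 ?opnorm_ge0.
rewrite [X in hnorm X](_ : _ = k *: A x) // hnormZ -mulrA.
by rewrite ler_wpM2l ?normc_ge0 ?opnormP.
Qed.

Lemma opnormZ (k : R[i]) A : opnorm (k *: A) = Normc.normc k * opnorm A.
Proof.
apply/le_anti; rewrite opnormZ_le /=.
have [->|k0] := eqVneq k 0.
  by rewrite Normc.normc0 mul0r opnorm_ge0.
have nk0 : 0 < Normc.normc k.
  by rewrite lt_def normc_ge0 andbT; apply: contra k0 => /eqP /Normc.eq0_normc ->.
have := opnormZ_le k^-1 (k *: A).
rewrite scalerA mulVf // scale1r Normc.normcV => h.
by rewrite -ler_pdivlMl.
Qed.

Let cnorm A : R[i] := (opnorm A)%:C%C.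

Let cnormD A B : cnorm (A + B) <= cnorm A + cnorm B.
Proof. by rewrite /cnorm -rmorphD lecR opnormD. Qed.

Let cnormZ (k : R[i]) A : cnorm (k *: A) = `|k| * cnorm A.
Proof. by rewrite /cnorm opnormZ rmorphM. Qed.

Let cnorm_eq0 A : cnorm A = 0 -> A = 0.
Proof. by move=> /complexI /opnorm_eq0. Qed.

HB.instance Definition _ :=
  Lmodule_isNormed.Build R[i] bop cnormD cnormZ cnorm_eq0.

Lemma norm_bopE A : `|A| = (opnorm A)%:C%C.
Proof. by []. Qed.

Fact bop_mul_subproof A B : (A \o B : H -> H) \in bounded_op.
Proof.
apply/asboolP; split.
- by move=> k x; rewrite /= !bopZ.
- exists (opnorm A * opnorm B); split=> [|x]; first by rewrite mulr_ge0 ?opnorm_ge0.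
  by rewrite /= (le_trans (opnormP A _)) // -mulrA ler_wpM2l ?opnorm_ge0 ?opnormP.
- by exists (bop_adj B \o bop_adj A) => x y; rewrite /= !bop_adjP.
Qed.

Definition bop_mul A B : bop := Bop (bop_mul_subproof A B).

Lemma opnormM A B : opnorm (bop_mul A B) <= opnorm A * opnorm B.
Proof.
apply: opnorm_le; split=> [|x]; first by rewrite mulr_ge0 ?opnorm_ge0.
by rewrite /= (le_trans (opnormP A _)) // -mulrA ler_wpM2l ?opnorm_ge0 ?opnormP.
Qed.

Lemma dot_bop_adj A x y : dot (bop_adj A x) y = dot x (A y).
Proof. by rewrite dotC -bop_adjP dotC. Qed.

(** Both the bound on the adjoint and the C*-identity come from the
    Cauchy-Schwarz inequality: the square of the norm of [A* y] is
    [dot (A (A* y)) y], and that of [A x] is [dot (A* (A x)) x]. *)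
Lemma bop_adj_bound A : bounded_by (opnorm A) (bop_adj A).
Proof.
split=> [|y]; first exact: opnorm_ge0.
have [->|y0] := eqVneq (hnorm (bop_adj A y)) 0.
  by rewrite mulr_ge0 ?opnorm_ge0 ?hnorm_ge0.
have yp : 0 < hnorm (bop_adj A y) by rewrite lt_def y0 hnorm_ge0.
rewrite -(ler_pM2l yp) -expr2 sqr_hnorm -bop_adjP.
rewrite (le_trans (cauchy_schwarz _ _)) // mulrA ler_wpM2r ?hnorm_ge0 //.
by rewrite mulrC opnormP.
Qed.

Fact bop_star_subproof A : bop_adj A \in bounded_op.
Proof.
apply/asboolP; split.
- by move=> k x; apply: dot_inj => z; rewrite dot_bop_adj !dotZ dot_bop_adj bopZ.
- by exists (opnorm A); exact: bop_adj_bound.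
- by exists A => x y; exact: dot_bop_adj.
Qed.

Definition bop_star A : bop := Bop (bop_star_subproof A).

Lemma dot_star A x y : dot (bop_star A x) y = dot x (A y).
Proof. exact: dot_bop_adj. Qed.

Lemma bop_star_uniq A B : adjoint_to A B -> bop_star A = B.
Proof.
move=> AB; apply: bop_inj => x; apply: dot_inj => y.
by rewrite dot_star dotC AB dotC.
Qed.

Lemma bop_starK : involutive bop_star.
Proof. by move=> A; apply: bop_star_uniq => x y; rewrite dot_star. Qed.

Lemma bop_starD : {morph bop_star : A B / A + B}.
Proof.
move=> A B; apply: bop_star_uniq => x y.
by rewrite [LHS]dotDl [RHS]dotDr !bop_adjP.
Qed.

Lemma bop_starZ (k : R[i]) A : bop_star (k *: A) = k^* *: bop_star A.
Proof.
apply: bop_star_uniq => x y.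
rewrite [LHS]dotZ [LHS]bop_adjP; congr dot.
by rewrite -[LHS]/(bop_star A _) bopZ.
Qed.

Lemma bop_starB : {morph bop_star : A B / A - B}.
Proof. by move=> A B; rewrite bop_starD -scaleN1r bop_starZ rmorphN1 scaleN1r. Qed.

Lemma bop_starM A B : bop_star (bop_mul A B) = bop_mul (bop_star B) (bop_star A).
Proof. by apply: bop_star_uniq => x y; rewrite /= !bop_adjP. Qed.

Lemma opnorm_star A : opnorm (bop_star A) <= opnorm A.
Proof. by apply: opnorm_le; exact: bop_adj_bound. Qed.

Lemma opnorm_starM A : opnorm (bop_mul (bop_star A) A) = opnorm A ^+ 2.
Proof.
apply/le_anti/andP; split.
  rewrite (le_trans (opnormM _ _)) // expr2.
  by rewrite ler_wpM2r ?opnorm_ge0 ?opnorm_star.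
rewrite -[leRHS]sqr_sqrtr ?opnorm_ge0 //.
rewrite ler_pXn2r ?nnegrE ?opnorm_ge0 ?sqrtr_ge0 //.
apply: opnorm_le; split=> [|x]; first exact: sqrtr_ge0.
apply: hnorm_le; first by rewrite mulr_ge0 ?sqrtr_ge0 ?hnorm_ge0.
rewrite -dot_star exprMn sqr_sqrtr ?opnorm_ge0 // expr2 mulrA.
rewrite (le_trans (cauchy_schwarz _ _)) // ler_wpM2r ?hnorm_ge0 //.
exact: (opnormP (bop_mul (bop_star A) A)).
Qed.

Definition hcvg (T : Type) (F : set_system T) (u : T -> H) (l : H) :=
  forall e : R, 0 < e -> \forall t \near F, hnorm (l - u t) <= e.

Lemma hcvg_dot (T : Type) (F : set_system T) (u : T -> H) (l y : H) :
  Filter F -> hcvg F u l -> dot (u t) y @[t --> F] --> dot l y.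
Proof.
move=> FF ul; apply/cvgrPdist_le => e e0.
have y0 : 0 < hnorm y + 1 by rewrite ltr_wpDl ?hnorm_ge0.
apply: filterS (ul (e / (hnorm y + 1)) (divr_gt0 e0 y0)) => t ut.
rewrite -dotBl ler_norml lerNl -dotNl.
have h z : hnorm z <= e / (hnorm y + 1) -> dot z y <= e.
  rewrite ler_pdivlMr // => zle; apply: le_trans (cauchy_schwarz _ _) _.
  by apply: le_trans zle; rewrite ler_wpM2l ?hnorm_ge0 // lerDl.
by rewrite !h // hnormN.
Qed.

Lemma hcvg_complete (T : Type) (F : set_system T) (u : T -> H) : ProperFilter F ->
  (forall e : R, 0 < e -> exists x, \forall t \near F, hnorm (u t - x) <= e) ->
  exists l, hcvg F u l.
Proof.
move=> FF cau.
have [e e0|l ul] := @hilbert_complete _ H (u @ F) _.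
  have [|x ux] := cau (Num.sqrt e); first by rewrite sqrtr_gt0.
  exists x; apply: filterS ux => t /=; rewrite -sqr_hnorm => h.
  by rewrite -[leRHS](sqr_sqrtr (ltW e0)) ler_pXn2r ?nnegrE ?hnorm_ge0 ?sqrtr_ge0.
exists l => e e0.
have : \forall t \near F, dot (l - u t) (l - u t) <= e ^+ 2.
  exact: ul (exprn_gt0 _ e0).
by apply: filterS => t; apply: hnorm_le; exact: ltW.
Qed.

Definition op_cauchy (F : set_system bop) :=
  forall e : R, 0 < e -> exists A, \forall B \near F, opnorm (A - B) <= e.

Lemma op_cauchy_cvg (F : set_system bop) : ProperFilter F -> op_cauchy F ->
  exists L : H -> H, forall x, hcvg F (fun B : bop => B x) (L x).
Proof.
move=> FF cau.
suff h x : exists l, hcvg F (fun B : bop => B x) l.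
  by exists (fun x => sval (cid (h x))) => x; exact: svalP (cid (h x)).
apply: hcvg_complete => e e0.
have x0 : 0 < hnorm x + 1 by rewrite ltr_wpDl ?hnorm_ge0.
have [A FA] := cau _ (divr_gt0 e0 x0); exists (A x).
apply: filterS FA => B; rewrite ler_pdivlMr // => AB.
rewrite -hnormN opprB; apply: le_trans AB; apply: le_trans (opnormP (A - B) x) _.
by rewrite ler_wpM2l ?opnorm_ge0 // lerDl.
Qed.

(** If [A] is close to the operators of [F] in norm then it is as close to
    their pointwise limit: this turns pointwise limits into norm limits. *)
Lemma op_lim_le (F : set_system bop) (L : H -> H) A (e : R) : ProperFilter F ->
  (forall x, hcvg F (fun B : bop => B x) (L x)) ->
  (\forall B \near F, opnorm (A - B) <= e) ->
  forall x, hnorm (L x - A x) <= e * hnorm x.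
Proof.
move=> FF FL FA x; apply/ler_addgt0Pr => d d0.
have [B [AB LB]] := filter_ex (filterI FA (FL x d d0)).
have -> : L x - A x = (L x - B x) - (A - B) x.
  by rewrite [(A - B) x](_ : _ = A x - B x) // opprB addrA addrNK.
rewrite (le_trans (hnormD _ _)) // addrC lerD // hnormN.
by rewrite (le_trans (opnormP _ _)) // ler_wpM2r ?hnorm_ge0.
Qed.

(** The adjoints of a Cauchy filter form a Cauchy filter as well, because
    the adjoint map is an isometry. The two pointwise limits are adjoint to
    each other, so the limit of the operators is an operator. *)
Lemma op_complete (F : set_system bop) : ProperFilter F -> op_cauchy F ->
  exists A, forall e : R, 0 < e -> \forall B \near F, opnorm (A - B) <= e.
Proof.
move=> FF cau.
have [L FL] := op_cauchy_cvg FF cau.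
have [|L' FL'] := @op_cauchy_cvg (bop_star @ F) _.
  move=> e /cau[A FA]; exists (bop_star A); apply: filterS FA => B AB.
  by rewrite /= -bop_starB (le_trans (opnorm_star _)).
have Ldot x y : dot (B x) y @[B --> F] --> dot (L x) y.
  exact: hcvg_dot (FL x).
have lim_eq (f g : bop -> R) (a b : R) :
    f =1 g -> f @ F --> a -> g @ F --> b -> a = b.
  by move=> /funext-> fa fb; exact: norm_cvg_unique fa fb.
have Lop : L \in bounded_op.
  apply/asboolP; split.
  - move=> k x; apply: dot_inj => z; rewrite dotZ.
    by apply: lim_eq (Ldot _ _) (Ldot _ _) => B; rewrite bopZ dotZ.
  - have [A FA] := cau 1 ltr01.
    exists (1 + opnorm A); split=> [|x]; first by rewrite addr_ge0 ?opnorm_ge0.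
    rewrite -[L x](subrK (A x)) (le_trans (hnormD _ _)) // mulrDl lerD ?opnormP //.
    exact: op_lim_le FA x.
  - exists L' => x y; rewrite [RHS]dotC.
    have L'dot : dot (bop_star B y) x @[B --> F] --> dot (L' y) x.
      exact: hcvg_dot (FL' y).
    by apply: lim_eq (Ldot _ _) L'dot => B; rewrite bop_adjP dotC.
exists (Bop Lop) => e e0.
have e20 : 0 < e / 2 by rewrite divr_gt0.
have [A FA] := cau _ e20; apply: filterS (FA) => B AB.
rewrite -[X in opnorm (X - _)](subrK A) -addrA (splitr e).
rewrite (le_trans (opnormD _ _)) // lerD //.
by apply: opnorm_le; split=> [|x]; [exact: ltW|exact: op_lim_le FA x].
Qed.

Lemma bop_complete (F : set_system bop) : ProperFilter F -> cauchy F -> cvg F.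
Proof.
move=> FF /cauchyP cau.
have [e e0|A FA] := @op_complete F FF.
  have [|A FA] := cau e%:C%C; first by rewrite ltcR.
  exists A; apply: filterS FA => B; rewrite -ball_normE /= norm_bopE ltcR.
  exact: ltW.
apply/cvg_ex; exists A; apply/cvgrPdist_le => e e0.
have eE : e = (complex.Re e)%:C%C by rewrite RRe_real // gtr0_real.
have {}e0 : 0 < complex.Re e by rewrite -ltcR -eE.
by apply: filterS (FA _ e0) => B; rewrite eE norm_bopE lecR.
Qed.

HB.instance Definition _ := Uniform_isComplete.Build bop bop_complete.

Fact bop_mulA : associative bop_mul.
Proof. by move=> A B C; apply: bop_inj. Qed.

Fact bop_mulZl (k : R[i]) A B : bop_mul (k *: A) B = k *: bop_mul A B.
Proof. exact: bop_inj. Qed.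

Fact bop_mulDl : left_distributive bop_mul +%R.
Proof. by move=> A B C; apply: bop_inj. Qed.

Fact bop_mulDr : right_distributive bop_mul +%R.
Proof. by move=> A B C; apply: bop_inj => x; rewrite [LHS]bopD. Qed.

Fact bop_mulZr (k : R[i]) A B : bop_mul A (k *: B) = k *: bop_mul A B.
Proof. by apply: bop_inj => x; rewrite [LHS]bopZ. Qed.

Fact bop_norm_mul A B : `|bop_mul A B| <= `|A| * `|B|.
Proof. by rewrite !norm_bopE -rmorphM lecR opnormM. Qed.

Fact bop_norm_starM A : `|bop_mul (bop_star A) A| = `|A| ^+ 2.
Proof. by rewrite !norm_bopE opnorm_starM rmorphXn. Qed.

HB.instance Definition _ := @CompleteNormedModule_isCStarAlgebra.Build R bop
  bop_mul bop_star bop_mulA bop_mulDl bop_mulDr bop_mulZl bop_mulZr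
  bop_starK bop_starD bop_starZ bop_starM bop_norm_mul bop_norm_starM.

End BoundedOperators.

(** * Square summable functions *)

#[local] Existing Instance totally_filter.

Section FiniteSums.
Variables (R : realType) (T : choiceType).
Implicit Types (F G : {fset T}) (h : T -> R).

Lemma ler_fsum h F G : (forall t, 0 <= h t) -> (F `<=` G)%fset ->
  \sum_(t <- F) h t <= \sum_(t <- G) h t.
Proof.
move=> h0 FG; rewrite (big_fsetID _ (mem F) G) /=.
have -> : [fset x in G | x \in F]%fset = F.
  by apply/fsetP => t; rewrite !inE /= andb_idl //; exact: (fsubsetP FG).
by rewrite lerDl sumr_ge0.
Qed.

(** The limit is the supremum of the finite sums, which increase along the
    filter of finite sets. *)
Lemma fsum_bounded_cvg h (M : R) : (forall t, 0 <= h t) ->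
  (forall F, \sum_(t <- F) h t <= M) -> cvg (\sum_(t <- F) h t @[F --> totally]).
Proof.
move=> h0 hM; set X := range (fun F => \sum_(t <- F) h t).
have supX : has_sup X.
  split; first by exists (\sum_(t <- fset0) h t), fset0.
  by exists M => _ [F _ <-].
apply/cvg_ex; exists (sup X); apply/cvgrPdist_le => e e0.
have [_ [F _ <-] Fe] := sup_adherent e0 supX.
exists F => // G /= FG.
rewrite ger0_norm ?subr_ge0; last by apply: ub_le_sup; [case: supX|exists G].
by have := ler_fsum h0 FG; lra.
Qed.

End FiniteSums.

Section Ell2.
Variables (R : realType) (T : choiceType).
Implicit Types (f g h : T -> R[i]) (F : {fset T}).

(** The real part of [z * w^*], that is, the dot product of the plane. *)
Definition cdot (z w : R[i]) : R :=
  complex.Re z * complex.Re w + complex.Im z * complex.Im w.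

Lemma cdotC z w : cdot z w = cdot w z.
Proof. by rewrite /cdot; ring. Qed.

Lemma cdotDl z w v : cdot (z + w) v = cdot z v + cdot w v.
Proof. by case: z w v => [a b] [c d] [e f]; rewrite /cdot /=; ring. Qed.

Lemma cdotZ k z w : cdot (k * z) w = cdot z (k^* * w).
Proof. by case: z w k => [a b] [c d] [e f]; rewrite /cdot /=; ring. Qed.

Lemma cdotRl (r : R) z w : cdot (r%:C%C * z) w = r * cdot z w.
Proof. by case: z w => [a b] [c d]; rewrite /cdot /=; ring. Qed.

Lemma cdot_ge0 z : 0 <= cdot z z.
Proof. by rewrite /cdot; nra. Qed.

Lemma cdot_eq0 z : cdot z z = 0 -> z = 0.
Proof.
case: z => a b; rewrite /cdot /= => h.
have [a0 b0] : a = 0 /\ b = 0 by split; nra.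
by rewrite a0 b0.
Qed.

Lemma cdotD_le z w : cdot (z + w) (z + w) <= 2 * cdot z z + 2 * cdot w w.
Proof.
case: z w => [a b] [c d]; rewrite /cdot /=.
have := sqr_ge0 (a - c); have := sqr_ge0 (b - d); nra.
Qed.

Definition fdot F f g : R := \sum_(t <- F) cdot (f t) (g t).

Lemma fdotD_le F f g : fdot F (f + g) (f + g) <= 2 * fdot F f f + 2 * fdot F g g.
Proof.
rewrite /fdot !mulr_sumr -big_split /=; apply: ler_sum => t _.
exact: cdotD_le.
Qed.

Definition square_summable : {pred T -> R[i]} :=
  [pred f | `[< exists M, forall F, fdot F f f <= M >]].

Lemma square_summable_submod : submod_closed square_summable.
Proof.
split.
  apply/asboolP; exists 0 => F; rewrite /fdot big1 // => t _.
  by rewrite /cdot /= !mul0r addr0.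
move=> k f g /asboolP[M fM] /asboolP[N gN]; apply/asboolP.
exists (2 * (Normc.normc k ^+ 2 * M) + 2 * N) => F.
apply: le_trans (fdotD_le _ _ _) _; apply: lerD; rewrite ler_pM2l //.
apply: le_trans (ler_wpM2l (sqr_ge0 _) (fM F)).
rewrite /fdot mulr_sumr; apply: ler_sum => t _; rewrite !fctE /=.
by rewrite cdotZ mulrA [_^* * _]mulrC -normCK normr_normc -rmorphXn cdotC cdotRl.
Qed.

HB.instance Definition _ :=
  GRing.isSubmodClosed.Build _ _ square_summable square_summable_submod.

Record ell2 := Ell2 { ell2_val :> T -> R[i]; _ : ell2_val \in square_summable }.
HB.instance Definition _ := [isSub for ell2_val].
HB.instance Definition _ := [Choice of ell2 by <:].
HB.instance Definition _ := [SubChoice_isSubLmodule of ell2 by <:].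

Implicit Types x y z : ell2.

Lemma ell2P x : exists M, forall F, fdot F x x <= M.
Proof. by case: x => f /= /asboolP. Qed.

Definition ldot x y : R := lim (fdot F x y @[F --> totally]).

Let ldot_cvg_sqr x : cvg (fdot F x x @[F --> totally]).
Proof.
have [M xM] := ell2P x.
by apply: (fsum_bounded_cvg (M := M)) => // t; exact: cdot_ge0.
Qed.

(** By polarization it is enough that the sums of nonnegative terms converge. *)
Lemma ldot_cvg x y : fdot F x y @[F --> totally] --> ldot x y.
Proof.
rewrite /ldot; have -> : (fun F => fdot F x y) =
    (fun F => 2^-1 * (fdot F (x + y) (x + y) - fdot F x x - fdot F y y)).
  apply/funext => F; rewrite /fdot -!sumrB mulr_sumr; apply: eq_bigr => t _.
  by rewrite [(x + y) t](_ : _ = x t + y t) // /cdot !raddfD /=; field.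
suff : cvg (2^-1 * (fdot F (x + y) (x + y) - fdot F x x - fdot F y y)
  @[F --> totally]) by [].
by apply: is_cvgMl_tmp; apply: is_cvgB => //; apply: is_cvgB.
Qed.

Lemma ldot_le x (M : R) : (forall F, fdot F x x <= M) -> ldot x x <= M.
Proof. by move=> xM; apply: limr_le; [exact: ldot_cvg|exact: nearW]. Qed.

Lemma fdot_le x F : fdot F x x <= ldot x x.
Proof.
apply: limr_ge; first exact: ldot_cvg.
by exists F => // G /= FG; apply: ler_fsum => // t; exact: cdot_ge0.
Qed.

Lemma cdot_le x t : cdot (x t) (x t) <= ldot x x.
Proof. by have := fdot_le x [fset t]%fset; rewrite /fdot big_seq_fset1. Qed.

Arguments ldot_cvg x y : clear implicits.

Let ldot_eq x y (u : {fset T} -> R) (l : R) :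
  u F @[F --> totally] --> l -> (forall F, fdot F x y = u F) -> ldot x y = l.
Proof. by move=> ul /funext xy; rewrite /ldot xy; exact: cvg_lim ul. Qed.

Lemma eq_ldot x y x' y' :
  (forall t, cdot (x t) (y t) = cdot (x' t) (y' t)) -> ldot x y = ldot x' y'.
Proof.
by move=> xy; apply: ldot_eq (ldot_cvg x' y') _ => F; apply: eq_bigr.
Qed.

Fact ldotC x y : ldot x y = ldot y x.
Proof. by apply: eq_ldot => t; exact: cdotC. Qed.

Fact ldotDl x y z : ldot (x + y) z = ldot x z + ldot y z.
Proof.
apply: ldot_eq (cvgD (ldot_cvg x z) (ldot_cvg y z)) _ => F.
rewrite -big_split; apply: eq_bigr => t _; exact: cdotDl.
Qed.

Fact ldotZ (k : R[i]) x y : ldot (k *: x) y = ldot x (k^* *: y).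
Proof. by apply: eq_ldot => t; exact: (cdotZ k (x t) (y t)). Qed.

Fact ldotRl (r : R) x y : ldot (r%:C%C *: x) y = r * ldot x y.
Proof.
apply: ldot_eq (cvgMl_tmp (a := r) (ldot_cvg x y)) _ => F.
by rewrite mulr_sumr; apply: eq_bigr => t _; exact: (cdotRl r (x t) (y t)).
Qed.

Fact ldot_ge0 x : 0 <= ldot x x.
Proof.
apply: limr_ge; first exact: ldot_cvg.
by apply: nearW => F; apply: sumr_ge0 => t _; exact: cdot_ge0.
Qed.

Lemma ell2_inj x y : (forall t, x t = y t) -> x = y.
Proof. by move=> xy; apply: val_inj; apply/funext. Qed.

Fact ldot_eq0 x : ldot x x = 0 -> x = 0.
Proof.
move=> x0; apply: ell2_inj => t; apply: cdot_eq0; apply/le_anti.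
by rewrite cdot_ge0 andbT -x0 cdot_le.
Qed.

Let cdotB (z w : R[i]) : cdot (z - w) (z - w) =
  (complex.Re z - complex.Re w) * (complex.Re z - complex.Re w) +
  (complex.Im z - complex.Im w) * (complex.Im z - complex.Im w).
Proof. by case: z w => [a b] [c d]. Qed.

Let ldotD_le x y : ldot (x + y) (x + y) <= 2 * ldot x x + 2 * ldot y y.
Proof.
apply: ldot_le => F; apply: le_trans (fdotD_le _ _ _) _.
by apply: lerD; rewrite ler_pM2l // fdot_le.
Qed.

Let ldotN x : ldot (- x) (- x) = ldot x x.
Proof. by rewrite -scaleN1r ldotZ scalerA rmorphN1 mulrNN mul1r scale1r. Qed.

(** The limit is taken coordinatewise. A bound by [e] on the square of the
    distance from [x] holds for the limit over every finite set of coordinates,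
    thus over all of them. *)
Fact ell2_complete (F : set_system ell2) : ProperFilter F ->
  (forall e, 0 < e -> exists x, F [set y | ldot (y - x) (y - x) <= e]) ->
  exists l, forall e, 0 < e -> F [set y | ldot (l - y) (l - y) <= e].
Proof.
move=> FF cau.
have coord (p : R[i] -> R) : (forall z w : R[i], p (z - w) = p z - p w) ->
    (forall z : R[i], p z ^+ 2 <= cdot z z) ->
    exists a : T -> R, forall t, p ((y : ell2) t) @[y --> F] --> a t.
  move=> pB p_le.
  suff h t : exists a : R, p ((y : ell2) t) @[y --> F] --> a.
    by exists (fun t => sval (cid (h t))) => t; exact: svalP (cid (h t)).
  apply/cvg_ex; apply: cauchy_cvg; apply/cauchy_exP => e e0.
  have [|x Fx] := cau ((e / 2) ^+ 2); first by rewrite exprn_gt0 ?divr_gt0.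
  exists (p (x t)); suff : F [set y : ell2 | ball (p (x t)) e (p (y t))] by [].
  apply: filterS Fx => y /= xy.
  rewrite /ball /= distrC (@le_lt_trans _ _ (e / 2)) //; last by lra.
  have e2 : 0 <= e / 2 by lra.
  rewrite -(ler_pXn2r (n := 2)) ?nnegrE ?normr_ge0 // -pB real_normK ?num_real //.
  exact: le_trans (p_le _) (le_trans (cdot_le (y - x) t) xy).
have [||a aE] := coord (@complex.Re R); first exact: raddfB.
  by move=> z; rewrite /cdot -!expr2 lerDl sqr_ge0.
have [||b bE] := coord (@complex.Im R); first exact: raddfB.
  by move=> z; rewrite /cdot -!expr2 lerDr sqr_ge0.
pose l t : R[i] := (a t +i* b t)%C.
have lim_fdot x G : fdot G (y - x) (y - x) @[y --> F] --> fdot G (l - x) (l - x).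
  apply: cvg_big => [|t _]; first exact: add_continuous.
  rewrite [X in _ --> X]cdotB.
  rewrite (_ : (fun y : ell2 => _) = fun y : ell2 =>
    (complex.Re (y t) - complex.Re (x t)) * (complex.Re (y t) - complex.Re (x t)) +
    (complex.Im (y t) - complex.Im (x t)) * (complex.Im (y t) - complex.Im (x t))).
    by apply: cvgD; apply: cvgM; apply: cvgB => //; apply: cvg_cst.
  by apply/funext => y; exact: cdotB.
have fdot_l x e : F [set y | ldot (y - x) (y - x) <= e] ->
    forall G, fdot G (l - x) (l - x) <= e.
  move=> Fx G; rewrite -(cvg_lim (@Rhausdorff R) (lim_fdot x G)).
  apply: limr_le; first by apply/cvg_ex; eexists; exact: lim_fdot.
  by apply: filterS Fx => y; apply: le_trans (fdot_le _ _).
have [x Fx] := cau 1 ltr01.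
have lx : l - x \in square_summable by apply/asboolP; exists 1; exact: fdot_l.
have lP : l \in square_summable.
  by rewrite -[l](subrK (x : T -> R[i])) rpredD //; case: (x).
exists (Ell2 lP) => e e0; have [|z Fz] := cau (e / 4).
  by rewrite divr_gt0.
apply: filterS (Fz) => y zy.
(* [l] and [y] are both close to [z]; each squared distance counts twice *)
rewrite /= -(subrK z (Ell2 lP)) -addrA (le_trans (ldotD_le _ _)) //.
have := ldot_le (x := Ell2 lP - z) (fdot_l _ _ Fz).
move: zy; rewrite /= -(ldotN (y - z)) opprB; lra.
Qed.

Definition ell2_hilbert : hilbert R :=
  Hilbert ldotC ldotDl ldotZ ldotRl ldot_ge0 ldot_eq0 ell2_complete.

End Ell2.

(** * Operators of partial bijections *)

Section PartialBijections.
Variables (R : realType) (T : choiceType).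
Local Notation H := (ell2_hilbert R T).
Implicit Types (f g : H) (s : T -> option T).

(** A partial bijection of [T], given with its inverse. *)
Definition inverse_pmaps s (s' : T -> option T) :=
  forall t u, s t = Some u <-> s' u = Some t.

Lemma inverse_pmaps_sym s (s' : T -> option T) :
  inverse_pmaps s s' -> inverse_pmaps s' s.
Proof. by move=> ss' t u; split=> /ss'. Qed.

Definition pullback s (f : T -> R[i]) : T -> R[i] := fun t => oapp f 0 (s t).

Section Compose.
Variables (s s' : T -> option T) (ss' : inverse_pmaps s s').

(** By injectivity of [s], the sum over [F] is a sum of distinct squares of
    values of [f]. *)
Lemma fdot_pullback f F : fdot F (pullback s f) (pullback s f) <= ldot f f.
Proof.
have us : uniq (pmap s F).
  apply: (@map_uniq _ _ s'); rewrite (_ : map s' _ = map some [seq t <- F | s t]).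
    by rewrite map_inj_uniq ?filter_uniq ?fset_uniq // => x y [].
  elim: (enum_fset F) => //= t r IHr; case st : (s t) => [u|//] /=.
  by rewrite IHr; move/ss' : st => ->.
apply: le_trans (fdot_le f [fset u in pmap s F]%fset).
rewrite /fdot [leRHS](perm_big (pmap s F)); last first.
  by apply: uniq_perm => // u; rewrite inE.
rewrite big_pmap le_eqVlt; apply/orP; left; apply/eqP.
apply: eq_bigr => t _; rewrite /pullback; case: (s t) => //=.
by rewrite /cdot /= !mul0r addr0.
Qed.

Fact pullback_subproof f : pullback s f \in @square_summable R T.
Proof. by apply/asboolP; exists (ldot f f); exact: fdot_pullback. Qed.

Definition pull f : H := Ell2 (pullback_subproof f).

Lemma pull_contr f : dot (pull f) (pull f) <= dot f f.
Proof. by apply: ldot_le => F; exact: fdot_pullback. Qed.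

Lemma pullD f g : pull (f + g) = pull f + pull g.
Proof.
apply: ell2_inj => t; rewrite [RHS](_ : _ = pull f t + pull g t) //.
by rewrite /= /pullback; case: (s t) => //=; rewrite addr0.
Qed.

Lemma pullZ (k : R[i]) f : pull (k *: f) = k *: pull f.
Proof.
apply: ell2_inj => t; rewrite [RHS](_ : _ = k * pull f t) //.
by rewrite /= /pullback; case: (s t) => //=; rewrite mulr0.
Qed.

End Compose.

Section Adjoint.
Variables (s s' : T -> option T).
Variables (ss' : inverse_pmaps s s') (s's : inverse_pmaps s' s).
Local Notation U := (pull ss').
Local Notation V := (pull s's).

Lemma pullK f : U (V (U f)) = U f.
Proof.
apply: ell2_inj => t; rewrite /= /pullback; case st : (s t) => [u|//] /=.
by move/ss' : (st) => -> /=; rewrite st.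
Qed.

Lemma pull_sym f g : dot (U (V f)) g = dot f (U (V g)).
Proof.
suff : ldot (U (V f)) g = ldot f (U (V g)) by [].
apply: eq_ldot => t; rewrite /= /pullback; case st : (s t) => [u|] /=.
  by move/ss' : (st) => ->.
by rewrite /cdot /= !mul0r !mulr0.
Qed.

(** Both operators are contractions and [U V U = U], so neither decreases the
    norm on the image of [U]. *)
Lemma pull_norm f : dot (U f) (U f) = dot (V (U f)) (V (U f)).
Proof.
apply/le_anti/andP; split; last exact: pull_contr.
by rewrite -{1 2}pullK; exact: pull_contr.
Qed.

End Adjoint.

(** [V] is isometric on the image of [U], hence preserves inner products there
    by polarization; the rest is the symmetry of the multiplications [U V] and
    [V U] by indicator functions. *)
Lemma pull_adj s (s' : T -> option T) (ss' : inverse_pmaps s s')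
  (s's : inverse_pmaps s' s) : adjoint_to (pull ss' : H -> H) (pull s's).
Proof.
move=> f g; rewrite -(pullK ss' s's) pull_sym.
set U := pull ss'; set V := pull s's.
have -> : dot (U f) (U (V g)) = dot (V (U f)) (V (U (V g))).
  rewrite [LHS]dot_polar [RHS]dot_polar -!pullD.
  by congr (_ * (_ - _ - _)); exact: pull_norm.
by rewrite pull_sym !pullK.
Qed.

Section Operator.
Variables (s s' : T -> option T) (ss' : inverse_pmaps s s').

Fact pull_op_subproof : (pull ss' : H -> H) \in @bounded_op R H.
Proof.
apply/asboolP; split; first exact: pullZ.
- exists 1; split=> // f; apply: hnorm_le; first by rewrite mul1r hnorm_ge0.
  by rewrite mul1r sqr_hnorm pull_contr.
- by exists (pull (inverse_pmaps_sym ss')); exact: pull_adj.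
Qed.

Definition pull_op : bop H := Bop pull_op_subproof.

Lemma pull_opE f t : pull_op f t = oapp f 0 (s t).
Proof. by []. Qed.

End Operator.

Lemma cstar_pull_op s (s' : T -> option T) (ss' : inverse_pmaps s s')
  (s's : inverse_pmaps s' s) : cstar (pull_op ss') = pull_op s's.
Proof. by apply: bop_star_uniq => f g; exact: pull_adj. Qed.

End PartialBijections.

(** * Edges of the topological graph with the same domain *)

Section Letters.
Variables (Lab : Type) (E : labeled_graph Lab).

Lemma rel_range1 (A : set (vertex E)) (a : Lab) v :
  rel_range A [:: a] v <->
  exists e : edge E, [/\ A (src e), label e = a & rng e = v].
Proof.
split=> [[[e [|f r]] [/= _ Ae]]|[e [Ae <- <-]]].
- by case=> <- <-; exists e.
- by [].
- by exists (e, [::]).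
Qed.

Lemma word_range1 (a : Lab) v :
  word_range E [:: a] v <-> exists2 e : edge E, label e = a & rng e = v.
Proof.
rewrite -rel_rangeT; split=> [/rel_range1[e [_ ea ev]]|[e ea ev]].
  by exists e.
by apply/rel_range1; exists e.
Qed.

Definition principal (v : vertex E) : set (set (vertex E)) :=
  [set A | accE E A /\ A v].

Lemma accE_I A B : accE E A -> accE E B -> accE E (A `&` B).
Proof. by have [_ _ h _ _] := accE_accommodating E; exact: h. Qed.

Lemma accE_D A B : accE E A -> accE E B -> accE E (A `\` B).
Proof. by have [_ _ _ h _] := accE_accommodating E; exact: h. Qed.

Lemma accE_U A B : accE E A -> accE E B -> accE E (A `|` B).
Proof. by have [_ h _ _ _] := accE_accommodating E; exact: h. Qed.

Lemma accE_0 : accE E set0.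
Proof. by have [] := accE_accommodating E. Qed.

Lemma accE_rel_range A (a : Lab) : accE E A -> accE E (rel_range A [:: a]).
Proof. by move=> /(ideal_rel_range a)[]. Qed.

(** The ideal contains relative complements: of two complementary sets below
    r(a), the one that contains [v] is in the principal filter. *)
Lemma principal_ideal_ultrafilter (a : Lab) v : word_range E [:: a] v ->
  ultrafilter (ideal E a) [set B | ideal E a B /\ B v].
Proof.
move=> av; have ra : ideal E a (word_range E [:: a]).
  by split=> //; exact: accE_range.
split.
  split.
  - by move=> B [].
  - by exists (word_range E [:: a]).
  - by move=> [].
  - move=> A A' [[hA Aa] Av] [[hA' _] A'v]; split=> //.
    by split; [exact: accE_I|exact: subIset (or_introl Aa)].
  - by move=> A A' [_ Av] hA' AA'; split=> //; exact: AA'.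
move=> eta [eE _ en0 eI eup] sub; apply/seteqP; split=> // A eA.
have [hA Aa] := eE _ eA; split=> //; apply: contrapT => nAv.
apply: en0; rewrite -(setICr A).
rewrite (_ : A `&` ~` A = A `&` (word_range E [:: a] `\` A)).
  apply: eI => //; apply: sub; split=> //.
  by split; [apply: accE_D => //; exact: accE_range|exact: subDsetl].
by rewrite setIDA (setIidl Aa) setIC setICl setDv.
Qed.

End Letters.

Section Injectivity.
Variables (Lab : finType) (E : labeled_graph Lab).
Hypotheses (hE : no_sinks_or_sources E) (hwlr : weakly_left_resolving E).

Lemma iota_principal (a : Lab) v : word_range E [:: a] v ->
  iota_set [set B | ideal E a B /\ B v] = principal v.
Proof.
move=> av; apply/seteqP; split=> A.
  by move=> [hA [B [_ Bv] BA]]; split=> //; exact: BA.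
move=> [hA Av]; split=> //; exists (A `&` word_range E [:: a]); last exact: subIsetl.
split=> //; split; last exact: subIsetr.
by apply: accE_I => //; exact: accE_range.
Qed.

Lemma iota_ideal (a : Lab) xi : ultrafilter (ideal E a) xi ->
  iota_set xi `&` ideal E a = xi.
Proof.
move=> [[sI [B xiB] n0 hI up] _].
apply/seteqP; split=> [A [[_ [C xiC CA]] iA]|A xiA]; first exact: up xiC iA CA.
by have [hA Aa] := sI _ xiA; split=> //; split=> //; exists A.
Qed.

Lemma iota_range (a : Lab) xi : ultrafilter (ideal E a) xi ->
  iota_set xi (word_range E [:: a]).
Proof.
move=> [[sI [B xiB] _ _ _] _]; split; first exact: accE_range.
by exists B => //; have [] := sI _ xiB.
Qed.

Lemma tdom_injectiveP :
  injective (@tdom (labeled_topological_graph hE hwlr)) <->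
  forall a b : Lab, a <> b -> word_range E [:: a] `&` word_range E [:: b] = set0.
Proof.
split=> [inj a b ab|dis].
  apply/seteqP; split=> // v [av bv]; apply: ab.
  pose e c (cv : word_range E [:: c] v) : labeled_tedge E :=
    existT _ c (exist _ _ (principal_ideal_ultrafilter cv)).
  suff : e a av = e b bv by move/(f_equal (@projT1 _ _)).
  apply: inj; apply: eq_exist => /=.
  by rewrite !iota_principal.
move=> [a [xi uxi]] [b [eta ueta]] /= /(f_equal sval)/= xieta.
have ab : a = b.
  apply: contrapT => /dis ab0; have [[_ _ n0 hI _] _] := iota_ultrafilter uxi.
  apply: n0; rewrite -ab0; apply: hI; first exact: iota_range.
  by rewrite xieta; exact: iota_range.
subst b; congr existT; apply: eq_exist.
by rewrite -(iota_ideal uxi) xieta iota_ideal.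
Qed.

End Injectivity.

Section Disjointify.
Variables (Lab : finType) (E : labeled_graph Lab).
Implicit Types c d : Lab.

(** The letters are ordered by [enum_rank]. Removing the ranges of the earlier
    letters makes the ranges disjoint without changing their union. *)
Definition fresh_range c : set (vertex E) :=
  word_range E [:: c] `\`
    \big[setU/set0]_(d : Lab | (enum_rank d < enum_rank c)%N) word_range E [:: d].

Lemma accE_bigU (I : Type) (r : seq I) (P : pred I) (X : I -> set (vertex E)) :
  (forall i, accE E (X i)) -> accE E (\big[setU/set0]_(i <- r | P i) X i).
Proof.
move=> accX; elim/big_rec: _ => [|i Y _]; first exact: accE_0.
exact: accE_U.
Qed.

Lemma accE_fresh_range c : accE E (fresh_range c).
Proof.
apply: accE_D; first exact: accE_range.
by apply: accE_bigU => d; exact: accE_range.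
Qed.

Lemma fresh_range_sub c : fresh_range c `<=` word_range E [:: c].
Proof. exact: subDsetl. Qed.

Lemma fresh_range_disj c d : (enum_rank c < enum_rank d)%N ->
  word_range E [:: c] `&` fresh_range d = set0.
Proof.
move=> cd; apply/seteqP; split=> // v [cv [_]]; apply.
by rewrite (bigD1 c) //=; left.
Qed.

Lemma fresh_range_trivI c d : c <> d -> fresh_range c `&` fresh_range d = set0.
Proof.
move=> cd; apply/seteqP; split=> // v [vc vd].
case: (ltngtP (enum_rank c) (enum_rank d)) => [lt|lt|/ord_inj/enum_rank_inj //].
  by rewrite -(fresh_range_disj lt); split=> //; exact: fresh_range_sub.
by rewrite -(fresh_range_disj lt); split=> //; exact: fresh_range_sub.
Qed.

Lemma fresh_range_cover : no_sinks_or_sources E ->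
  \big[setU/set0]_(c : Lab) fresh_range c = setT.
Proof.
move=> [_ rngS]; apply/seteqP; split=> // v _.
have [e _ ev] := rngS v I.
have vP : exists c, `[< word_range E [:: c] v >].
  by exists (label e); apply/asboolP/word_range1; exists e.
case: (arg_minnP (fun c => enum_rank c : nat) (svalP (sigW vP))).
move=> c /asboolP cv cmin.
rewrite (bigD1 c) //=; left; split=> //.
elim/big_ind: _ => [[]|X Y nX nY []//|d dc dv].
by have := cmin d (asboolT dv); rewrite leqNgt dc.
Qed.

End Disjointify.

Section CStarLemmas.
Variables (R : realType) (A : cstarAlgType R).
Implicit Types x y : A.

Lemma cmul0l x : 0 ** x = 0.
Proof. by have := cmulZl 0 0 x; rewrite !scale0r. Qed.

Lemma cmul0r x : x ** 0 = 0.
Proof. by have := cmulZr 0 x 0; rewrite !scale0r. Qed.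

Lemma cstar0 : cstar 0 = 0 :> A.
Proof. by have := cstarZ 0 (0 : A); rewrite rmorph0 !scale0r. Qed.

Lemma cmul_suml (I : Type) (r : seq I) (P : pred I) (f : I -> A) x :
  (\sum_(i <- r | P i) f i) ** x = \sum_(i <- r | P i) f i ** x.
Proof.
exact: (big_morph (fun y => y ** x) (fun y z => cmulDl y z x) (cmul0l x)).
Qed.

Lemma cmul_sumr (I : Type) (r : seq I) (P : pred I) (f : I -> A) x :
  x ** (\sum_(i <- r | P i) f i) = \sum_(i <- r | P i) x ** f i.
Proof. exact: (big_morph (fun y => x ** y) (cmulDr x) (cmul0r x)). Qed.

Lemma cstar_sum (I : Type) (r : seq I) (P : pred I) (f : I -> A) :
  cstar (\sum_(i <- r | P i) f i) = \sum_(i <- r | P i) cstar (f i).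
Proof. exact: (big_morph (@cstar R A) (@cstarD R A) cstar0). Qed.

End CStarLemmas.

Section FiniteCase.
Variables (R : realType) (Lab : finType) (E : labeled_graph Lab).
Variables (A : cstarAlgType R) (p : set (vertex E) -> A) (s : Lab -> A).
Hypotheses (hE : no_sinks_or_sources E) (rep : representation p s).
Implicit Types (X Y : set (vertex E)) (c d : Lab).

Let accT : accE E setT := accE_setT hE.

Lemma rep_bigU (I : eqType) (r : seq I) (X : I -> set (vertex E)) : uniq r ->
  (forall i, accE E (X i)) -> (forall i j, i <> j -> X i `&` X j = set0) ->
  p (\big[setU/set0]_(i <- r) X i) = \sum_(i <- r) p (X i).
Proof.
move=> ur accX disX; elim: r ur => [|i r IHr] /=.
  by rewrite !big_nil (rep0 rep).
move=> /andP[ir /IHr IH]; rewrite !big_cons (repU rep) ?IH //; last first.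
  exact: accE_bigU.
rewrite (_ : _ `&` _ = set0) ?(rep0 rep) ?subr0 //.
rewrite big_seq; elim/big_ind: _ => [|Y Z iY iZ|j jr].
- exact: setI0.
- by rewrite setIUr iY iZ setU0.
- by apply: disX => ij; move: ir; rewrite ij jr.
Qed.

Lemma rep_mul_sub X Y : accE E X -> accE E Y -> X `<=` Y -> p X ** p Y = p X.
Proof. by move=> hX hY XY; rewrite -(repI rep) // (setIidl XY). Qed.

Lemma rep_mul_sup X Y : accE E X -> accE E Y -> X `<=` Y -> p Y ** p X = p X.
Proof. by move=> hX hY XY; rewrite -(repI rep) // (setIidr XY). Qed.

Lemma rep_star X : accE E X -> cstar (p X) = p X.
Proof. by move=> /(rep_proj rep)[]. Qed.

Let fr := @fresh_range Lab E.
Let accfr c : accE E (fr c). Proof. exact: accE_fresh_range. Qed.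
Let accr c : accE E (word_range E [:: c]). Proof. exact: accE_range. Qed.

(** An isometry for the projection [p setT], with range projection [t t*]. *)
Let t : A := \sum_(c : Lab) s c ** p (fr c).

Let star_t : cstar t = \sum_(c : Lab) p (fr c) ** cstar (s c).
Proof. by rewrite /t cstar_sum; apply: eq_bigr => c _; rewrite cstarM rep_star. Qed.

Let star_s_t c : cstar (s c) ** t = p (fr c).
Proof.
rewrite /t cmul_sumr (bigD1 c) //= big1 ?addr0 => [|d /eqP dc].
  by rewrite cmulA (rep_source rep) rep_mul_sup //; exact: fresh_range_sub.
by rewrite cmulA (rep_orth rep) ?cmul0l //; exact: nesym.
Qed.

Let star_t_s c : cstar t ** s c = p (fr c).
Proof. by rewrite -[s c]cstarK -cstarM star_s_t rep_star. Qed.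

Let star_t_t : cstar t ** t = p setT.
Proof.
rewrite {1}star_t cmul_suml -(fresh_range_cover hE) rep_bigU ?index_enum_uniq //.
  apply: eq_bigr => c _; rewrite -cmulA star_s_t.
  by have [] := rep_proj rep (accfr c).
exact: fresh_range_trivI.
Qed.

Let t_unit : t ** p setT = t.
Proof.
by rewrite /t cmul_suml; apply: eq_bigr => c _; rewrite -cmulA rep_mul_sub.
Qed.

Let unit_t : p setT ** t = t.
Proof.
rewrite /t cmul_sumr; apply: eq_bigr => c _; rewrite cmulA (rep_comm rep) //.
by rewrite rel_rangeT -cmulA rep_mul_sup //; exact: fresh_range_sub.
Qed.

Let q := t ** cstar t.

Lemma finite_isometry : finite_cstar A -> q = p setT.
Proof.
move=> fin; apply: contrapT => qT; apply: (fin (p setT)).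
split; first exact: (rep_proj rep accT).
exists q; split=> //.
- split; first by rewrite /q cstarM cstarK.
  by rewrite /q -cmulA [cstar t ** _]cmulA star_t_t cmulA t_unit.
- by rewrite /subprojection /q cmulA unit_t.
- by exists t.
Qed.

(** Compressing [t t* = p setT] by [s d] gives [p (fr d) = p (r(d))], whereas
    [fr d] misses the range of every earlier letter. *)
Lemma finite_range_meet0 c d : finite_cstar A -> c <> d ->
  p (word_range E [:: c] `&` word_range E [:: d]) = 0.
Proof.
move=> fin cd.
wlog lt : c d cd / (enum_rank c < enum_rank d)%N => [th|].
  case: (ltngtP (enum_rank c) (enum_rank d)) => [|lt|/ord_inj/enum_rank_inj //].
    exact: th.
  by rewrite setIC; apply: th => //; exact: nesym.
have frd : p (word_range E [:: d]) = p (fr d).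
  transitivity (cstar (s d) ** (p setT ** s d)).
    rewrite (rep_comm rep) // rel_rangeT cmulA (rep_source rep).
    by rewrite rep_mul_sub.
  rewrite -finite_isometry // /q -cmulA star_t_s cmulA star_s_t.
  by have [] := rep_proj rep (accfr d).
rewrite (repI rep) // frd -(repI rep) // fresh_range_disj //; exact: rep0 rep.
Qed.

End FiniteCase.

(** * The representation on infinite paths *)

Section PathSpace.
Variables (Lab : finType) (E : labeled_graph Lab).
Hypotheses (hE : no_sinks_or_sources E) (hwlr : weakly_left_resolving E).
Implicit Types (a b : Lab) (X Y : set (vertex E)).

Let accT : accE E setT := accE_setT hE.

(** If [src e] were outside [X], it would be in the complement of [X], and the
    range of [e] would be in the relative ranges of both sets; their meet is
    the relative range of the empty set. *)
Lemma theta_principal (e : edge E) :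
  theta_set (label e) (principal (rng e)) = principal (src e).
Proof.
apply/seteqP; split=> X [hX]; last first.
  move=> Xe; split=> //; split; first exact: accE_rel_range.
  by apply/rel_range1; exists e.
move=> [_ Xe]; split=> //; apply: contrapT => nXe.
suff : rel_range (X `&` (setT `\` X)) [:: label e] (rng e).
  by rewrite setIDA setIT setDv rel_range0.
rewrite -hwlr //; [|exact: accE_D|exact: words1].
by split=> //; apply/rel_range1; exists e.
Qed.

(** The traces of infinite paths: at each time the ultrafilter of the current
    vertex and the label of the next edge. Keeping the vertices themselves
    would not make prepending a letter single-valued, since edges with the same
    label and range may have distinct sources. *)
Definition state_path : Type := nat -> set (set (vertex E)) * Lab.
Implicit Types x y : state_path.

Definition step (xi : set (set (vertex E))) a (eta : set (set (vertex E))) :=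
  exists e : edge E,
    [/\ principal (src e) = xi, label e = a & principal (rng e) = eta].

Definition admissible x := forall n, step (x n).1 (x n).2 (x n.+1).1.

Definition shift x : state_path := fun n => x n.+1.

Definition extend a x : state_path :=
  fun n => if n is m.+1 then x m else (theta_set a (x 0%N).1, a).

Definition cylinder X x := admissible x /\ (x 0%N).1 X.

Definition starts_with a x := admissible x /\ (x 0%N).2 = a.

Lemma stepP xi a eta : step xi a eta ->
  theta_set a eta = xi /\ eta (word_range E [:: a]).
Proof.
move=> [e [<- <- <-]]; split; first exact: theta_principal.
by split; [exact: accE_range|apply/word_range1; exists e].
Qed.

Lemma admissible_shift x : admissible x -> admissible (shift x).
Proof. by move=> px n; exact: px. Qed.

Lemma shift_extend a x : shift (extend a x) = x.
Proof. by []. Qed.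

Lemma extend_shift a x : starts_with a x -> extend a (shift x) = x.
Proof.
move=> [px xa]; apply/funext => -[|n] //=.
have [th _] := stepP (px 0%N).
by rewrite [RHS]surjective_pairing -xa -th.
Qed.

Lemma starts_with_extend a x :
  cylinder (word_range E [:: a]) x -> starts_with a (extend a x).
Proof.
move=> [px xa]; split=> // -[|n]; last exact: px.
have [f [fx _ _]] := px 0%N.
move: xa; rewrite /= -fx => -[_ /word_range1[e ea ev]].
by exists e; split=> //; [rewrite -theta_principal ea ev|rewrite ev].
Qed.

Lemma cylinder_shift a x :
  starts_with a x -> cylinder (word_range E [:: a]) (shift x).
Proof.
move=> [px xa]; split; first exact: admissible_shift.
by have [] := stepP (px 0%N); rewrite xa.
Qed.

(** The set-theoretic content of both the commutation relation and the
    decomposition of [p X] over the letters. *)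
Lemma cylinder_starts_with a X x : accE E X -> starts_with a x ->
  cylinder X x <-> cylinder (rel_range X [:: a]) (shift x).
Proof.
move=> hX [px xa]; have [th _] := stepP (px 0%N).
split=> -[_ Xx].
- split; first exact: admissible_shift.
  by move: Xx; rewrite -th xa => -[].
- by split=> //; rewrite -th xa; split.
Qed.

Lemma cylinder0 x : ~ cylinder set0 x.
Proof. by move=> [px]; have [e [<- _ _] []] := px 0%N. Qed.

Lemma cylinderI X Y x : accE E X -> accE E Y ->
  cylinder (X `&` Y) x <-> cylinder X x /\ cylinder Y x.
Proof.
move=> hX hY; split=> [[px]|[[px] + [_]]]; have [e [ex _ _]] := px 0%N;
  rewrite /cylinder -ex.
  by move=> [_ [Xe Ye]].
by move=> [_ Xe] [_ Ye]; split=> //; split; first exact: accE_I.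
Qed.

Lemma cylinderU X Y x : accE E X -> accE E Y ->
  cylinder (X `|` Y) x <-> cylinder X x \/ cylinder Y x.
Proof.
move=> hX hY; split=> [[px]|[[px]|[px]]]; have [e [ex _ _]] := px 0%N;
  rewrite /cylinder -ex.
- by move=> [_ [Xe|Ye]]; [left|right].
- by move=> [_ Xe]; split=> //; split; [exact: accE_U|left].
- by move=> [_ Ye]; split=> //; split; [exact: accE_U|right].
Qed.

Lemma starts_with_out_labels a X x :
  starts_with a x -> cylinder X x -> out_labels X a.
Proof.
move=> [px <-] [_]; have [e [<- <- _]] := px 0%N.
by move=> [_ Xe]; exists e.
Qed.

Lemma cylinder_nonempty X v : accE E X -> X v -> exists x, cylinder X x.
Proof.
move=> hX Xv; have [srcS _] := hE.
have [out outE] : exists out : vertex E -> edge E, forall w, src (out w) = w.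
  have h w : exists e : edge E, src e = w by have [e _ <-] := srcS w I; exists e.
  by exists (fun w => sval (cid (h w))) => w; exact: svalP (cid (h w)).
pose w n := iter n (fun w => rng (out w)) v.
exists (fun n => (principal (w n), label (out (w n)))); split=> // n.
by exists (out (w n)); rewrite outE.
Qed.

Definition cylinder_map X x : option state_path :=
  if `[< cylinder X x >] then Some x else None.

Definition shift_map a x : option state_path :=
  if `[< starts_with a x >] then Some (shift x) else None.

Definition extend_map a x : option state_path :=
  if `[< cylinder (word_range E [:: a]) x >] then Some (extend a x) else None.

Lemma cylinder_mapE X x y : cylinder_map X x = Some y <-> cylinder X x /\ x = y.
Proof. by rewrite /cylinder_map; case: asboolP => cx; split=> [[]|[]] // _ ->. Qed.

Lemma shift_mapE a x y : shift_map a x = Some y <-> starts_with a x /\ shift x = y.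
Proof. by rewrite /shift_map; case: asboolP => cx; split=> [[]|[]] // _ ->. Qed.

Lemma extend_mapE a x y : extend_map a x = Some y <->
  cylinder (word_range E [:: a]) x /\ extend a x = y.
Proof. by rewrite /extend_map; case: asboolP => cx; split=> [[]|[]] // _ ->. Qed.

Lemma cylinder_map_inverse X : inverse_pmaps (cylinder_map X) (cylinder_map X).
Proof. by move=> x y; rewrite !cylinder_mapE; split=> -[+ xy]; rewrite xy. Qed.

Lemma shift_extend_inverse a : inverse_pmaps (shift_map a) (extend_map a).
Proof.
move=> x y; rewrite shift_mapE extend_mapE; split=> -[h <-].
  by split; [exact: cylinder_shift|exact: extend_shift].
by split; [exact: starts_with_extend|exact: shift_extend].
Qed.

Variable R : realType.
Local Notation H := (ell2_hilbert R state_path).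

Definition path_proj X : bop H := pull_op R (cylinder_map_inverse X).
Definition path_isom a : bop H := pull_op R (shift_extend_inverse a).

Lemma path_op_inj (S S' : bop H) : (forall (f : H) x, S f x = S' f x) -> S = S'.
Proof. by move=> SS'; apply: bop_inj => f; apply: ell2_inj => x; exact: SS'. Qed.

Lemma path_projE X (f : H) x :
  path_proj X f x = if `[< cylinder X x >] then f x else 0.
Proof. by rewrite pull_opE /cylinder_map; case: ifP. Qed.

Lemma path_isomE a (f : H) x :
  path_isom a f x = if `[< starts_with a x >] then f (shift x) else 0.
Proof. by rewrite pull_opE /shift_map; case: ifP. Qed.

Lemma star_path_isomE a (f : H) x : cstar (path_isom a) f x =
  if `[< cylinder (word_range E [:: a]) x >] then f (extend a x) else 0.
Proof.
rewrite (cstar_pull_op R _ (inverse_pmaps_sym (shift_extend_inverse a))) pull_opE.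
by rewrite /extend_map; case: ifP.
Qed.

Lemma star_path_proj X : cstar (path_proj X) = path_proj X.
Proof. exact: cstar_pull_op. Qed.

Lemma path_op_sumE (S : Lab -> bop H) (P : pred Lab) (f : H) x :
  (\sum_(a | P a) S a) f x = \sum_(a | P a) S a f x.
Proof. by apply: (big_morph (fun S : bop H => S f x)). Qed.

(** All the relations compare functions of the form [f (s x)] for partial maps
    [s] of the space of paths, so they reduce to the combinatorics of cylinders. *)
Lemma path_representation : representation path_proj path_isom.
Proof.
have mulE (S S' : bop H) (f : H) : (S ** S') f = S (S' f) by [].
split.
- move=> X hX; split; first exact: star_path_proj.
  apply: path_op_inj => f x; rewrite mulE !path_projE.
  by case: asboolP.
- move=> a; apply: path_op_inj => f x; rewrite !mulE.
  rewrite !path_isomE; case: asboolP => // ax.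
  rewrite star_path_isomE asboolT ?path_isomE; last exact: cylinder_shift.
  by rewrite extend_shift // asboolT.
- apply: path_op_inj => f x; rewrite path_projE asboolF //.
  exact: cylinder0.
- move=> X Y hX hY; apply: path_op_inj => f x; rewrite mulE !path_projE.
  have h := cylinderI x hX hY.
  case: (asboolP (cylinder X x)); case: (asboolP (cylinder Y x));
    by case: (asboolP (cylinder (X `&` Y) x)) => //; tauto.
- move=> X Y hX hY; apply: path_op_inj => f x.
  rewrite [RHS](_ : _ =
    path_proj X f x + path_proj Y f x - path_proj (X `&` Y) f x) //.
  rewrite !path_projE.
  have hi := cylinderI x hX hY; have hu := cylinderU x hX hY.
  case: (asboolP (cylinder X x)); case: (asboolP (cylinder Y x));
    case: (asboolP (cylinder (X `&` Y) x)); case: (asboolP (cylinder (X `|` Y) x));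
    by rewrite ?(addr0, add0r, subr0, addrK) //; tauto.
- move=> X a hX; apply: path_op_inj => f x.
  rewrite !mulE path_projE !path_isomE path_projE.
  case: (asboolP (starts_with a x)) => [ax|_]; last by case: ifP.
  have h := cylinder_starts_with hX ax.
  case: (asboolP (cylinder X x));
    by case: (asboolP (cylinder (rel_range X [:: a]) (shift x))) => //; tauto.
- move=> a; apply: path_op_inj => f x; rewrite mulE star_path_isomE path_projE.
  case: asboolP => // ax; rewrite path_isomE asboolT ?shift_extend //.
  exact: starts_with_extend.
- move=> a b ab; apply: path_op_inj => f x; rewrite mulE star_path_isomE.
  case: asboolP => // ax; rewrite path_isomE asboolF // => -[_ ba].
  by apply: ab; rewrite -ba.
- move=> X hX; apply: path_op_inj => f x; rewrite path_op_sumE.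
  (* conjugating by [path_isom a] restricts to the paths that start with [a] *)
  have term a :
      (path_isom a ** path_proj (rel_range X [:: a]) ** cstar (path_isom a)) f x
      = if `[< starts_with a x /\ cylinder X x >] then f x else 0.
    rewrite !mulE path_isomE.
    case: (asboolP (starts_with a x)) => ax; last by rewrite asboolF // => -[].
    rewrite path_projE star_path_isomE extend_shift //.
    rewrite (asboolT (cylinder_shift ax)).
    have h := cylinder_starts_with hX ax.
    case: (asboolP (starts_with a x /\ cylinder X x));
      by case: (asboolP (cylinder (rel_range X [:: a]) (shift x))) => //; tauto.
  rewrite path_projE; case: asboolP => [Xx|nXx]; last first.
    by rewrite big1 // => a _; rewrite term asboolF // => -[].
  (* the only contribution is that of the first letter of [x] *)
  have ax : starts_with (x 0%N).2 x by have [] := Xx.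
  rewrite (bigD1 (x 0%N).2); last first.
    by apply/asboolP; exact: starts_with_out_labels ax Xx.
  rewrite term asboolT // big1 /= ?addr0 // => a /andP[_ /eqP ne].
  by rewrite [LHS]term asboolF // => -[[_ xa] _]; apply: ne.
Qed.

Lemma dirac_subproof x0 :
  (fun x : state_path => (x == x0)%:R : R[i]) \in @square_summable R state_path.
Proof.
apply/asboolP; exists 1 => F; rewrite /fdot.
have [x0F|x0F] := boolP (x0 \in F).
  rewrite (big_fsetD1 x0) //= eqxx big1_seq ?addr0 => [|x].
    by rewrite /cdot /= !mul1r mul0r addr0.
  move=> /andP[_]; rewrite !inE => /andP[/negPf-> _].
  by rewrite /cdot /= !mul0r addr0.
rewrite big1_seq ?ler01 // => x /= xF; rewrite (_ : (x == x0) = false).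
  by rewrite /cdot /= !mul0r addr0.
by apply: contraNF x0F => /eqP <-.
Qed.

(** The projection fixes the indicator function of [x]. *)
Lemma path_proj_neq0 X x : cylinder X x -> path_proj X <> 0.
Proof.
move=> Xx /(f_equal (fun S : bop H => S (Ell2 (dirac_subproof x)) x)).
rewrite path_projE asboolT //= eqxx => /eqP.
by rewrite oner_eq0.
Qed.

End PathSpace.

Theorem proposition4p3 (R : realType) (Lab : finType) (E : labeled_graph Lab)
    (hE : no_sinks_or_sources E) (hwlr : weakly_left_resolving E) :
  (injective (@tdom (labeled_topological_graph hE hwlr)) <->
     forall a b : Lab, a <> b -> word_range E [:: a] `&` word_range E [:: b] = set0) /\
  (forall (A : cstarAlgType R) (p : set (vertex E) -> A) (s : Lab -> A),
     is_labeled_graph_cstar p s -> finite_cstar A ->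
     forall a b : Lab, a <> b -> word_range E [:: a] `&` word_range E [:: b] = set0).
Proof.
split; first exact: tdom_injectiveP.
move=> A p s [rep _ univ] fin a b ab; apply/seteqP; split=> // v vab.
have hX : accE E (word_range E [:: a] `&` word_range E [:: b]).
  by apply: accE_I; exact: accE_range.
have [x Xx] := cylinder_nonempty hE hX vab.
have [phi [_ phip _]] := univ _ _ _ (path_representation hE hwlr R).
apply: (path_proj_neq0 (R := R) Xx).
by rewrite -phip // (finite_range_meet0 hE rep) // linear0.
Qed.
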